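(* Up to (positive) scaling, the set of all $\varphi\in\mathfrak h_{\mathbf R}^*$ belonging to the dominant Weyl chamber $C$, such that $v=ih_\varphi$ has compact isotropy, and satisfying $\varphi'=\lambda\varphi$ for some $\lambda\neq0$, is finite.
   Context: $G$ is a non-compact real semisimple Lie group with Lie algebra $\mathfrak g$ and Killing form $B$; isotropy means stabilizer in $G$ for the adjoint action. $\mathfrak g=\mathfrak k\oplus\mathfrak p$ is a Cartan decomposition with $\mathfrak k$ a maximal compact subalgebra, and $\mathfrak h_0\subset\mathfrak k$ is a maximal abelian subalgebra whose complexification is a Cartan subalgebra of $\mathfrak g_c=\mathfrak g\otimes\mathbf C$. $\Delta$ is the set of roots, which are real on $\mathfrak h_{\mathbf R}=i\mathfrak h_0$, where $B$ is positive definite. For $\psi\in\mathfrak h_{\mathbf R}^*$, $h_\psi\in\mathfrak h_{\mathbf R}$ is defined by $\psi(h)=B(h_\psi,h)$, and $(\psi,\psi')=B(h_\psi,h_{\psi'})$ is the induced scalar product on $\mathfrak h_{\mathbf R}^*$. A root $\alpha$ is compact ($\varepsilon_\alpha=-1$) if its root space lies in $\mathfrak k_c$, and non-compact ($\varepsilon_\alpha=1$) if it lies in $\mathfrak p_c$. A positive root system $\Delta^+\subset\Delta$ is fixed, and $C=\{\psi\in\mathfrak h_{\mathbf R}^*:(\psi,\alpha)\ge0\text{ for all }\alpha\in\Delta^+\}$ is its dominant Weyl chamber. For $\varphi\in C$, let $\varphi^\perp$ be the set of elements orthogonal to $\varphi$ and $$\varphi'=-2\sum_{\alpha\in\Delta^+\setminus\varphi^\perp}\varepsilon_\alpha\,\alpha\in\mathfrak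 h_{\mathbf R}^*.$$ *)

(* Defs.v *)
From HB Require Import structures.
From mathcomp Require Import all_boot all_order all_algebra.
From mathcomp Require Import all_classical all_reals all_analysis.
From mathcomp.real_closed Require Import complex.
Set Implicit Arguments.
Unset Strict Implicit.
Unset Printing Implicit Defensive.
Import Order.TTheory GRing.Theory Num.Theory.
Import numFieldNormedType.Exports.
Import VectorInternalTheory.
Local Open Scope classical_set_scope.
Local Open Scope ring_scope.
Local Open Scope complex_scope.

HB.mixin Record isLieAlgebra (K : fieldType) V of Vector K V := {
  lie : V -> V -> V;
  lie_linearl : forall y, linear (lie^~ y);
  lie_linearr : forall x, linear (lie x);
  liexx : forall x, lie x x = 0;
  lie_jacobi : forall x y z,
    lie x (lie y z) + lie y (lie z x) + lie z (lie x y) = 0 }.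

#[short(type="lieAlgType")]
HB.structure Definition LieAlgebra (K : fieldType) :=
  {V of Vector K V & isLieAlgebra K V}.

Section LieAlgebraTheory.
Variables (K : fieldType) (L : lieAlgType K).
Implicit Types (U W : {vspace L}) (x y : L).

Definition subalgebra U := forall x y, x \in U -> y \in U -> lie x y \in U.

Definition ideal U := forall x y, y \in U -> lie x y \in U.

Definition abelian_space U := forall x y, x \in U -> y \in U -> lie x y = 0.

(* By bilinearity this is the span of all brackets of U with W. *)
Definition lie_prod U W : {vspace L} :=
  <<[seq lie x y | x <- vbasis U, y <- vbasis W]>>%VS.

Definition solvable_space U :=
  exists k : nat, iter k (fun W => lie_prod W W) U = 0%VS.

Definition nilpotent_space U :=
  exists k : nat, iter k (fun W => lie_prod U W) U = 0%VS.

Definition semisimple_lie :=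
  forall U, ideal U -> solvable_space U -> U = 0%VS.

Definition cartan_subalgebra U :=
  [/\ subalgebra U, nilpotent_space U
    & forall x, (forall y, y \in U -> lie x y \in U) -> x \in U].

Definition ad x : 'End(L) := linfun (lie x).

Definition killing x y : K := 
  let e := vbasis {:L} in \tr (passmx.mxof e e (ad x \o ad y)%VF).

Definition maximal_abelian_in U W :=
  [/\ (W <= U)%VS, abelian_space W
    & forall A : {vspace L},
        (A <= U)%VS -> abelian_space A -> (W <= A)%VS -> A = W].

End LieAlgebraTheory.

Definition cartan_involution (R : realFieldType) (g : lieAlgType R)
    (theta : 'End(g)) :=
  [/\ forall x y : g, theta (lie x y) = lie (theta x) (theta y),
      (theta \o theta)%VF = \1%VF
    & forall x : g, x != 0 -> 0 < - killing x (theta x)].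

Definition cartan_decomposition (R : realFieldType) (g : lieAlgType R)
    (k p : {vspace g}) :=
  exists theta : 'End(g),
    [/\ cartan_involution theta,
        forall x, (x \in k) = (theta x == x)
      & forall x, (x \in p) = (theta x == - x)].

(* The pair (x, y) stands for x + i y. *)
Definition complexification (V : Type) : Type := (V * V)%type.

HB.instance Definition _ (V : zmodType) :=
  GRing.Zmodule.copy (complexification V) (V * V)%type.

Section Complexification.
Variable R : rcfType.

Section Lmod.
Variable V : lmodType R.

Definition cscale (a : R[i]) (z : complexification V) : complexification V :=
  let: a1 +i* a2 := a in (a1 *: z.1 - a2 *: z.2, a1 *: z.2 + a2 *: z.1).

Fact cscaleA a b z : cscale a (cscale b z) = cscale (a * b) z.
Proof.
case: a b z => [a1 a2] [b1 b2] [x y] /=.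
congr pair; rewrite !(scalerDr, scalerDl, scalerN, scaleNr, scalerA, opprD).
  by rewrite !addrA (ACl (1*4*2*3)).
by rewrite !addrA (ACl (1*4*2*3)).
Qed.
Fact cscale1 : left_id 1 cscale.
Proof. by case=> x y /=; rewrite !scale1r !scale0r subr0 addr0. Qed.
Fact cscaleDr : right_distributive cscale +%R.
Proof.
case=> a1 a2 [x y] [x' y'] /=; congr pair => /=; rewrite !scalerDr.
  by rewrite opprD addrACA.
by rewrite addrACA.
Qed.
Fact cscaleDl z : {morph cscale^~ z : a b / a + b}.
Proof.
case: z => [x y] [a1 a2] [b1 b2] /=; congr pair => /=; rewrite !scalerDl.
  by rewrite opprD addrACA.
by rewrite addrACA.
Qed.

HB.instance Definition _ := GRing.Zmodule_isLmodule.Build R[i]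
  (complexification V) cscaleA cscale1 cscaleDr cscaleDl.

Definition cplx (x : V) : complexification V := (x, 0).

End Lmod.

Section Vect.
Variable V : vectType R.

Fact complexification_vect_iso : Vector.axiom (dim V) (complexification V).
Proof.
pose f (z : complexification V) : 'rV[R[i]]_(dim V) :=
  \row_j ((v2r z.1 0 j) +i* (v2r z.2 0 j)).
exists f.
  move=> [a1 a2] [x y] [x' y']; apply/rowP => j; rewrite !mxE /=.
  rewrite !linearD !linearN !linearZ /= !mxE.
  by rewrite mulrN [in RHS]/GRing.mul [in RHS]/GRing.add /=.
exists (fun u => (r2v (map_mx (@complex.Re R) u), r2v (map_mx (@complex.Im R) u))).
  by case=> x y; congr pair => /=; apply: (can_inj v2rK); rewrite r2vK;
    apply/rowP => j; rewrite !mxE.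
by move=> u; apply/rowP => j; rewrite !mxE /= !r2vK !mxE; case: (u 0 j).
Qed.

HB.instance Definition _ := Lmodule_hasFinDim.Build R[i]
  (complexification V) complexification_vect_iso.

Definition complexify (U : {vspace V}) : {vspace complexification V} :=
  <<[seq cplx x | x <- vbasis U]>>%VS.

End Vect.

Section Lie.
Variable g : lieAlgType R.

Definition clie (z w : complexification g) : complexification g :=
  (lie z.1 w.1 - lie z.2 w.2, lie z.1 w.2 + lie z.2 w.1).

Let lieDl (x y z : g) : lie (x + y) z = lie x z + lie y z.
Proof. by have := lie_linearl z 1 x y; rewrite !scale1r. Qed.
Let lieDr (x y z : g) : lie z (x + y) = lie z x + lie z y.
Proof. by have := lie_linearr z 1 x y; rewrite !scale1r. Qed.
Let lie0l (z : g) : lie 0 z = 0.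
Proof. by apply: (addrI (lie 0 z)); rewrite -lieDl !addr0. Qed.
Let lie0r (z : g) : lie z 0 = 0.
Proof. by apply: (addrI (lie z 0)); rewrite -lieDr !addr0. Qed.
Let lieZl a (x z : g) : lie (a *: x) z = a *: lie x z.
Proof. by have := lie_linearl z a x 0; rewrite !addr0 lie0l addr0. Qed.
Let lieZr a (x z : g) : lie z (a *: x) = a *: lie z x.
Proof. by have := lie_linearr z a x 0; rewrite !addr0 lie0r addr0. Qed.
Let lieNl (x z : g) : lie (- x) z = - lie x z.
Proof. by rewrite -scaleN1r lieZl scaleN1r. Qed.
Let lieNr (x z : g) : lie z (- x) = - lie z x.
Proof. by rewrite -scaleN1r lieZr scaleN1r. Qed.
Let lieC (x y : g) : lie x y = - lie y x.
Proof.
apply/eqP; rewrite -addr_eq0; apply/eqP.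
have := liexx (x + y); rewrite lieDl !lieDr !liexx.
by rewrite add0r addr0.
Qed.

Fact clieC z w : clie z w = - clie w z.
Proof.
case: z w => [x y] [x' y']; congr pair => /=.
  by rewrite (lieC x) (lieC y) opprD.
by rewrite (lieC x) (lieC y) opprD addrC.
Qed.
Fact clie_linearr z : linear (clie z).
Proof.
case: z => [x y] [a1 a2] [x1 y1] [x2 y2]; rewrite /clie /=.
congr pair; rewrite /= !(lieDr, lieZr, lieNr, scalerDr, scalerN, opprD).
  by rewrite !addrA [LHS](ACl (1*4*2*5*3*6)).
by rewrite !addrA [LHS](ACl (1*4*2*5*3*6)).
Qed.
Fact clie_linearl w : linear (clie^~ w).
Proof.
move=> a z z'; rewrite clieC clie_linearr opprD -clieC.
by rewrite -scalerN -clieC.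
Qed.
Fact cliexx z : clie z z = 0.
Proof. by rewrite /clie !liexx subr0 (lieC z.2) addrN. Qed.
Fact clie_jacobi x y z :
  clie x (clie y z) + clie y (clie z x) + clie z (clie x y) = 0.
Proof.
case: x y z => [x x'] [y y'] [z z'].
congr pair; rewrite /= !(lieDr, lieNr, opprD) !addrA.
  rewrite (ACl ((1*5*9)*(2*8*11)*(3*6*12)*(4*7*10))) /=.
  by rewrite -!opprD !lie_jacobi !oppr0 !addr0.
rewrite (ACl ((1*6*11)*(2*7*9)*(3*5*10)*(4*8*12))) /=.
by rewrite -!opprD !lie_jacobi oppr0 !addr0.
Qed.

HB.instance Definition _ := isLieAlgebra.Build R[i] (complexification g)
  clie_linearl clie_linearr cliexx clie_jacobi.
End Lie.
End Complexification.

Section LieGroups.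
Variable R : realType.

(* Meant for an open set A: the values of f outside of A are irrelevant. *)
Fixpoint class_C (U V : normedModType R) (k : nat) (A : set U) (f : U -> V) :=
  match k with
  | 0 => forall x, A x -> {for x, continuous f}
  | k'.+1 => forall x, A x ->
      differentiable f x /\ forall v, class_C k' A (fun y => 'D_v f y)
  end.

Definition smooth_on (U V : normedModType R) (A : set U) (f : U -> V) :=
  forall k, class_C k A f.

Record chart (n : nat) (M : topologicalType) := Chart {
  chart_dom : set M;
  chart_fun :> M -> 'rV[R]_n;
  chart_inv : 'rV[R]_n -> M;
  chart_dom_open : open chart_dom;
  chart_cod_open : open (chart_fun @` chart_dom);
  chart_funK : forall x, chart_dom x -> chart_inv (chart_fun x) = x;
  chart_continuous : forall x, chart_dom x -> {for x, continuous chart_fun};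
  chart_inv_continuous : forall u, (chart_fun @` chart_dom) u ->
    {for u, continuous chart_inv} }.

End LieGroups.

HB.mixin Record isLieGroup (R : realType) (n : nat) G
    of Topological G & Group G := {
  lie_hausdorff : hausdorff_space G;
  lie_second_countable : @second_countable G;
  lie_mul_continuous : continuous (fun z : G * G => (z.1 * z.2)%g);
  lie_inv_continuous : continuous (fun a : G => (a^-1)%g);
  lie_atlas : set (chart R n G);
  lie_atlas_cover : forall a : G, exists2 c, lie_atlas c & chart_dom c a;
  lie_atlas_compatible : forall c d, lie_atlas c -> lie_atlas d ->
    smooth_on (c @` (chart_dom c `&` chart_dom d)) (d \o chart_inv c);
  lie_mul_smooth : forall b c d, lie_atlas b -> lie_atlas c -> lie_atlas d ->
    smooth_on
      [set z : 'rV[R]_n * 'rV[R]_n |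
        [/\ (b @` chart_dom b) z.1, (c @` chart_dom c) z.2
          & chart_dom d (chart_inv b z.1 * chart_inv c z.2)%g]]
      (fun z => d (chart_inv b z.1 * chart_inv c z.2)%g);
  lie_inv_smooth : forall c d, lie_atlas c -> lie_atlas d ->
    smooth_on
      [set u | (c @` chart_dom c) u /\ chart_dom d ((chart_inv c u)^-1)%g]
      (fun u => d ((chart_inv c u)^-1)%g) }.

#[short(type="lieGroupType")]
HB.structure Definition LieGroup (R : realType) (n : nat) :=
  {G of Topological G & Group G & isLieGroup R n G}.

(* The tangent space of G at the identity is read off in a chart c around the
   identity, so that tangent vectors are row vectors. *)
Section AdjointInChart.
Variables (R : realType) (n : nat) (G : lieGroupType R n) (c : chart R n G).
Implicit Types (a : G) (X Y : 'rV[R]_n).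

Definition chart_Ad a X : 'rV[R]_n :=
  'D_X (fun u => c (a * chart_inv c u * a^-1)%g) (c 1%g).

(* ad is the differential of Ad at the identity. *)
Definition chart_lie X Y : 'rV[R]_n :=
  'D_X (fun u => chart_Ad (chart_inv c u) Y) (c 1%g).

End AdjointInChart.

Record lie_algebra_of (R : realType) (n : nat) (G : lieGroupType R n)
    (g : lieAlgType R) := LieAlgebraOf {
  la_chart : chart R n G;
  la_chart_atlas : lie_atlas la_chart;
  la_chart1 : chart_dom la_chart 1%g;
  la_iso : 'Hom(g, 'rV[R]_n);
  la_iso_inj : lker la_iso = 0%VS;
  la_iso_surj : limg la_iso = fullv;
  la_iso_lie : forall x y : g,
    la_iso (lie x y) = chart_lie la_chart (la_iso x) (la_iso y) }.

Definition Ad (R : realType) (n : nat) (G : lieGroupType R n)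
    (g : lieAlgType R) (Gg : lie_algebra_of G g) (a : G) (x : g) : g :=
  (la_iso Gg)^-1%VF (chart_Ad (la_chart Gg) a (la_iso Gg x)).

Definition isotropy (R : realType) (n : nat) (G : lieGroupType R n)
    (g : lieAlgType R) (Gg : lie_algebra_of G g) (x : g) : set G :=
  [set a | Ad Gg a x = x].

Section Roots.
Variables (R : realType) (g : lieAlgType R).
Variables (k p h0 : {vspace g}).

(* i h0, as a real subspace of the complexification; the pair type carries
   the real vector space structure of the complexification. *)
Definition real_cartan : {vspace (g * g)%type} :=
  (linfun (fun x : g => 'i%C *: cplx x : (g * g)%type) @: h0)%VS.

Definition hR := subvs_of real_cartan.

Definition hR_val (h : hR) : complexification g := vsval h.

Definition hR_dual := 'Hom(hR, R^o).

Implicit Types (psi phi alpha : hR_dual) (Dp : set hR_dual).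

(* Roots are real on i h0, and a root is determined there: it is represented by
   its restriction. *)
Definition root_space alpha : set (complexification g) :=
  [set x | forall h : hR, lie (hR_val h) x = (alpha h)%:C *: x].

Definition roots : set hR_dual :=
  [set alpha | alpha != 0 /\ exists2 x, root_space alpha x & x != 0].

Definition compact_root alpha := root_space alpha `<=` [set` complexify k].
Definition noncompact_root alpha := root_space alpha `<=` [set` complexify p].

(* 1 on non-compact roots, -1 on compact ones: a root is exactly one of them. *)
Definition root_sign alpha : R :=
  (`[< noncompact_root alpha >])%:R - (`[< compact_root alpha >])%:R.

Definition dual_vect psi : hR :=
  xget 0 [set h | forall h' : hR, (psi h')%:C = killing (hR_val h) (hR_val h')].

Definition dual_dot psi phi : R :=
  complex.Re (killing (hR_val (dual_vect psi)) (hR_val (dual_vect phi))).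

Definition positive_system Dp :=
  [/\ Dp `<=` roots,
      forall alpha, roots alpha -> Dp alpha \/ Dp (- alpha),
      forall alpha, ~ (Dp alpha /\ Dp (- alpha))
    & forall alpha beta, Dp alpha -> Dp beta -> roots (alpha + beta) ->
        Dp (alpha + beta)].

Definition dominant_chamber Dp : set hR_dual :=
  [set psi | forall alpha, Dp alpha -> 0 <= dual_dot psi alpha].

Definition orthogonal_to phi : set hR_dual := [set psi | dual_dot psi phi = 0].

Definition phi_prime Dp phi : hR_dual :=
  - 2 *: \sum_(alpha \in Dp `\` orthogonal_to phi) (root_sign alpha *: alpha).

Definition pos_ray phi : set hR_dual :=
  [set psi | exists2 t : R, 0 < t & psi = t *: phi].

End Roots.

(* Main.v *)
Require Import Defs.
From HB Require Import structures.
From mathcomp Require Import all_boot all_order all_algebra.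
From mathcomp Require Import all_classical all_reals all_analysis.
From mathcomp Require Import finmap.
From mathcomp.real_closed Require Import complex.
Import Order.TTheory GRing.Theory Num.Theory.
Import numFieldNormedType.Exports.
Local Open Scope classical_set_scope.
Local Open Scope ring_scope.
Local Open Scope complex_scope.

(** The number [lambda] only matters through its sign, and [phi'] only depends
    on which positive roots are orthogonal to [phi].  Indeed, if
    [phi' = lambda phi] with [lambda] nonzero, then the ray of [phi] is the ray
    of [phi'] or that of [- phi'], according to the sign of [lambda]; and
    [phi'] is minus twice the sum of the signed roots over a subset of the
    positive roots.  There are finitely many such subsets since there are
    finitely many roots, so only finitely many rays can occur.

    Finiteness of the roots ([finite_roots]) holds because root vectors are
    simultaneous eigenvectors of the operators [ad h]: when they belong to
    distinct roots they are linearly independent ([weight_vectors_indep]), so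
    their number is bounded by the dimension of the complexified algebra. *)

HB.instance Definition _ (K : fieldType) (L : lieAlgType K) (x : L) :=
  GRing.isLinear.Build K L L *:%R (lie x) (lie_linearr x).

(** As in the case of one operator: applying [act h - a ord0 h] to a linear
    relation kills its first term, and multiplies each other coefficient by
    [a i h - a ord0 h], which is nonzero for some [h] depending on [i]. *)
Lemma weight_vectors_indep {F : fieldType} {V : lmodType F} {H : Type}
    {act : H -> {linear V -> V}} {m : nat} {a : 'I_m -> H -> F}
    {x : 'I_m -> V} :
    injective a -> (forall i, x i != 0) ->
    (forall i h, act h (x i) = a i h *: x i) ->
  forall c : 'I_m -> F, \sum_i c i *: x i = 0 -> forall i, c i = 0.
Proof.
elim: m a x => [|m IHm] a x a_inj x_neq0 x_weight c rel_c; first by case.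
have c_lift i : c (lift ord0 i) = 0.
  have [h a_neq] : exists h, a (lift ord0 i) h != a ord0 h.
    apply: contrapT => /forallNP a_eq.
    have /a_inj/eqP : a (lift ord0 i) = a ord0.
      by apply/funext => h; apply/eqP; apply: contrapT => /negP /a_eq.
    by rewrite eq_sym (negPf (neq_lift _ _)).
  pose c' j := c (lift ord0 j) * (a (lift ord0 j) h - a ord0 h).
  suff /eqP : c' i = 0 by rewrite mulf_eq0 subr_eq0 (negPf a_neq) orbF => /eqP.
  apply: (IHm (a \o lift ord0) (x \o lift ord0)) => //=.
    by move=> j l /a_inj/lift_inj.
  have : act h (\sum_j c j *: x j) - a ord0 h *: \sum_j c j *: x j = 0.
    by rewrite rel_c linear0 scaler0 subr0.
  rewrite linear_sum scaler_sumr -sumrB big_ord_recl /=.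
  rewrite linearZ /= x_weight !scalerA mulrC subrr add0r => {2}<-.
  apply: eq_bigr => j _.
  by rewrite /c' linearZ /= x_weight !scalerA -scalerBl mulrBr [_ * c _]mulrC.
move=> i; have [j ->|->] := unliftP ord0 i; first exact: c_lift.
move: rel_c; rewrite big_ord_recl big1 ?addr0 => [/eqP|j _].
  by rewrite scaler_eq0 (negPf (x_neq0 _)) orbF => /eqP.
by rewrite c_lift scale0r.
Qed.

Lemma weights_le_dim {F : fieldType} {V : vectType F} {H : Type}
    (act : H -> {linear V -> V}) (m : nat) (a : 'I_m -> H -> F) :
    injective a ->
    (forall i, exists2 x, forall h, act h x = a i h *: x & x != 0) ->
  (m <= \dim {:V})%N.
Proof.
move=> a_inj /fin_all_exists2[x x_weight x_neq0].
pose X := [tuple x i | i < m].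
suff /eqP X_free : free X.
  by rewrite -(size_tuple X) -X_free dimvS ?subvf.
apply/freeP => c rel_c.
apply: (weight_vectors_indep a_inj x_neq0 x_weight).
by rewrite -[RHS]rel_c; apply: eq_bigr => i _; rewrite -tnth_nth tnth_mktuple.
Qed.

Lemma finite_subsets (T : choiceType) (A : set T) :
  finite_set A -> finite_set [set D | D `<=` A].
Proof.
move=> A_fin.
apply: (@sub_finite_set _ _
    ((fun Y : {fset T} => [set` Y]) @` [set` fpowerset (fset_set A)])).
  move=> D /= subDA; have D_fin := sub_finite_set subDA A_fin.
  exists (fset_set D); last exact: fset_setK.
  rewrite /= fpowersetE; apply/fsubsetP => x; rewrite !in_fset_set //.
  by move=> /set_mem/subDA/mem_set.
exact/finite_image/finite_fset.
Qed.

Section FiniteRays.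
Context {R : realType} {g : lieAlgType R} {h0 : {vspace g}}.
Implicit Types (phi psi : hR_dual h0) (D : set (hR_dual h0)).

Lemma finite_roots : finite_set (@Defs.roots R g h0).
Proof.
apply: contrapT => roots_inf.
have [B Broots] := infinite_set_fset (\dim {:complexification g}).+1 roots_inf.
rewrite leqNgt ltnS => /negP; apply.
pose alpha (i : 'I_(size (enum_fset B))) : hR_dual h0 := (enum_fset B)`_i.
have Balpha i : Defs.roots (alpha i) by apply: Broots; apply: mem_nth.
apply: (@weights_le_dim _ _ _ (fun h : hR h0 => lie (hR_val h))
          _ (fun i h => (alpha i h)%:C)) => [i j eq_ij|i]; last first.
  by have [_] := Balpha i.
have eq_alpha : alpha i = alpha j.
  by apply/lfunP => h; have := congr1 (@^~ h) eq_ij => /= -[].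
apply/val_inj/eqP.
by rewrite -(nth_uniq 0 (ltn_ord i) (ltn_ord j) (fset_uniq B)); apply/eqP.
Qed.

Lemma pos_rayZ (t : R) phi : 0 < t -> pos_ray (t *: phi) = pos_ray phi.
Proof.
move=> t_gt0; apply/seteqP; split => _ [s s_gt0 ->].
  by exists (s * t); rewrite ?mulr_gt0 ?scalerA.
exists (s / t); first by rewrite divr_gt0.
by rewrite scalerA divfK // gt_eqF.
Qed.

Lemma pos_ray_eigen {lambda : R} {phi psi} :
    lambda != 0 -> psi = lambda *: phi ->
  pos_ray phi = pos_ray psi \/ pos_ray phi = pos_ray (- psi).
Proof.
move=> lambda_neq0 ->; have [l_lt0|l_gt0|] := ltgtP lambda 0.
- by right; rewrite -scaleNr pos_rayZ ?oppr_gt0.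
- by left; rewrite pos_rayZ.
- by move/eqP; rewrite (negPf lambda_neq0).
Qed.

End FiniteRays.

Theorem proposition4p3 (R : realType) (n : nat) (G : lieGroupType R n)
    (g : lieAlgType R) (Gg : lie_algebra_of G g) (k p h0 : {vspace g})
    (Dp : set (hR_dual h0))
    (G_noncompact : ~ compact [set: G])
    (g_semisimple : semisimple_lie g)
    (kp_cartan : cartan_decomposition k p)
    (h0_maximal : maximal_abelian_in k h0)
    (h0_cartan : cartan_subalgebra (complexify h0))
    (Dp_positive : positive_system Dp) :
  finite_set
    (@pos_ray R g h0 @`
       [set phi : hR_dual h0 |
          [/\ dominant_chamber Dp phi,
              exists v : g, cplx v = 'i%C *: hR_val (dual_vect phi) /\
                compact (isotropy Gg v)
            & exists2 lambda : R, lambda != 0 &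
                phi_prime k p Dp phi = lambda *: phi]]).
Proof.
have [Dp_roots _ _ _] := Dp_positive.
pose sum_over (D : set (hR_dual h0)) : hR_dual h0 :=
  - 2 *: \sum_(alpha \in D) (root_sign k p alpha *: alpha).
pose S := sum_over @` [set D | D `<=` Dp].
have S_fin : finite_set S.
  apply/finite_image/finite_subsets.
  exact: sub_finite_set Dp_roots finite_roots.
apply: (@sub_finite_set _ _
    (@pos_ray R g h0 @` S `|` (fun psi => @pos_ray R g h0 (- psi)) @` S)).
  move=> _ [phi [_ _ [lambda lambda_neq0 phi_eigen]] <-].
  have S_prime : S (phi_prime k p Dp phi).
    by exists (Dp `\` orthogonal_to phi) => //; apply: subDsetl.
  have [->|->] := pos_ray_eigen lambda_neq0 phi_eigen.
    by left; exists (phi_prime k p Dp phi).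
  by right; exists (phi_prime k p Dp phi).
by rewrite finite_setU; split; apply: finite_image.
Qed.
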